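(* Let $G=(V,E)$ be a finite connected graph with vertex measure $\mu:V\to(0,+\infty)$ and symmetric edge measure $\omega:E\to(0,+\infty)$. Let $h,f:V\to\mathbb{R}$ be functions with $f_i>0$ for every $i\in V$, and let $\alpha,p$ be real numbers with $\alpha\geq p>1$. Then there exist a constant $\lambda\in\mathbb{R}$ and a function $\varphi:V\to\mathbb{R}$ with $\varphi_i>0$ for every $i\in V$ such that $$\Delta_p\varphi_i+h_i\varphi_i^{p-1}=\lambda f_i\varphi_i^{\alpha-1}\qquad\text{for all } i\in V.$$
   Context: $G=(V,E)$ is a finite undirected graph with vertex set $V$ and edge set $E$; $i\sim j$ means that the vertices $i$ and $j$ are joined by an edge. $G$ is equipped with a fixed vertex measure $\mu:V\to(0,+\infty)$, $i\mapsto\mu_i$, and a fixed edge measure $\omega:E\to(0,+\infty)$ which is symmetric, i.e. $\omega_{ij}=\omega_{ji}$ for each edge $i\sim j$. $C(V)$ denotes the space of all real functions on $V$; the value of $u\in C(V)$ at $i$ is written $u_i$. For $p>1$, the discrete $p$-Laplacian $\Delta_p:C(V)\to C(V)$ is defined by $$\Delta_p u_i=\frac{1}{\mu_i}\sum_{j\sim i}\omega_{ij}|u_j-u_i|^{p-2}(u_j-u_i),\qquad u\in C(V),\ i\in V,$$ where a term with $u_j=u_i$ is taken to be $0$ (relevant when $1<p<2$). *)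

(* Defs.v *)
From HB Require Import structures.
From mathcomp Require Import all_boot all_order all_algebra.
From mathcomp Require Import all_classical all_reals all_analysis.

Set Implicit Arguments.
Unset Strict Implicit.
Unset Printing Implicit Defensive.

Import Order.TTheory GRing.Theory Num.Theory.
Local Open Scope ring_scope.

(* An undirected graph on [V] is a symmetric adjacency relation [adj].  The
   edge measure is a function on pairs of vertices; its values on pairs that
   are not edges are never used. *)

Definition graph_connected (V : finType) (adj : rel V) : Prop :=
  forall i j : V, connect adj i j.

(* Since [0 `^ a] is [0] or [1], a summand with [u j = u i] is [0] for all
   [p], including [1 < p < 2]. *)
Definition plaplacian (R : realType) (V : finType) (adj : rel V)
    (mu : V -> R) (omega : V -> V -> R) (p : R) (u : V -> R) (i : V) : R :=
  (mu i)^-1 *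
    \sum_(j | adj i j) omega i j * `|u j - u i| `^ (p - 2) * (u j - u i).

(* Main.v *)
(* Minimize [E(u) = 1/2 sum_ij omega_ij |u_j - u_i|^p - sum_i mu_i h_i |u_i|^p]
   on the compact set [N(u) = sum_i mu_i f_i |u_i|^alpha = 1].  Since
   [E(|u|) <= E(u)], there is a nonnegative minimizer [phi], with value [m].
   By homogeneity [m N(v)^(p/alpha) <= E(v)] for every [v], with equality at
   [phi]: no Lagrange multiplier is needed, the difference of the two sides is
   minimal at [phi] over the whole space, so its partial derivatives vanish
   there.  This is the equation with [lambda = - m].  Where [phi_i = 0] it reads
   [sum_(j ~ i) omega_ij phi_j^(p-1) = 0], so the zero set of [phi] is closed
   under adjacency; by connectedness and [N(phi) = 1] it is empty. *)
Require Import Defs.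
From HB Require Import structures.
From mathcomp Require Import all_boot all_order all_algebra.
From mathcomp Require Import all_classical all_reals all_analysis.
From mathcomp Require Import ring lra.

Set Implicit Arguments.
Unset Strict Implicit.
Unset Printing Implicit Defensive.

Import Order.TTheory GRing.Theory Num.Theory.
Local Open Scope ring_scope.
Import numFieldNormedType.Exports.
Local Open Scope classical_set_scope.

(** * The derivative of [|x|^p] for [p > 1], and Fermat's rule at a global minimum *)

Section RealFunctions.
Variable R : realType.
Implicit Types (a p x : R).

(** The odd extension of [x^(p-1)], that is, the derivative of [|x|^p / p]; it is also the
    nonlinearity in [plaplacian]. *)
Definition spow p x : R := `|x| `^ (p - 2) * x.

Lemma spow0 p : spow p 0 = 0.
Proof. by rewrite /spow mulr0. Qed.

Lemma spowN p x : spow p (- x) = - spow p x.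
Proof. by rewrite /spow normrN mulrN. Qed.

Lemma ge0_spow p x : 1 < p -> 0 <= x -> spow p x = x `^ (p - 1).
Proof.
move=> p1; rewrite le_eqVlt => /predU1P[<-|x0].
  by rewrite spow0 powR0 // subr_eq0 gt_eqF.
rewrite /spow gtr0_norm // -[X in _ * X](powRr1 (ltW x0)) -powRD.
  by congr (_ `^ _); lra.
by rewrite (gt_eqF x0) implybT.
Qed.

Lemma norm_spow p x : 1 < p -> `|spow p x| = `|x| `^ (p - 1).
Proof.
move=> p1; rewrite -ge0_spow // /spow normrM normr_id.
by rewrite (ger0_norm (powR_ge0 _ _)).
Qed.

(** The Carathéodory slope [g] satisfies [g z * (z - x) >= 0] by minimality. If [g x] were nonzero,
    [g] would keep its sign near [x], and a nearby point on the suitable side of [x] would violate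
    this. *)
Lemma is_derive_at_min (f : R -> R) x a :
  is_derive x 1 f a -> (forall y, f x <= f y) -> a = 0.
Proof.
move=> /is_derive1_caratheodory[g [fg gc <-]] fmin.
have gs z : 0 <= g z * (z - x) by rewrite -fg subr_ge0.
apply/eqP/negP => /negP; rewrite neq_lt => /orP[g0|g0].
  have /nbhs_ballP[e /= e0 ge] : \forall z \near x, g z < 0.
    exact: (cvgr_lt (g x) gc).
  have /ge : ball x e (x + e / 2).
    by rewrite /ball /= opprD addrA subrr sub0r normrN gtr0_norm; lra.
  by have := gs (x + e / 2); nra.
have /nbhs_ballP[e /= e0 ge] : \forall z \near x, 0 < g z.
  exact: (cvgr_gt (g x) gc).
have /ge : ball x e (x - e / 2).
  by rewrite /ball /= opprB addrCA subrr addr0 gtr0_norm; lra.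
by have := gs (x - e / 2); nra.
Qed.

Lemma is_derive_norm_powR p x : 1 < p ->
  is_derive x 1 (fun y : R => `|y| `^ p) (p * spow p x).
Proof.
move=> p1; have posE (y : R) : 0 < y ->
    is_derive y 1 (fun y : R => `|y| `^ p) (p * spow p y).
  move=> y0; rewrite ge0_spow ?ltW //.
  apply: near_eq_is_derive; last exact: is_derive1_powR.
  by near=> z; rewrite gtr0_norm //; near: z; exact: lt_nbhsr.
have [x0|x0|->] := ltgtP x 0; last 1 first.
(* At the origin the slope function is [spow p] itself, since [|z|^p = spow p z * z]; its continuity
   at 0 is where [p > 1] enters. *)
- rewrite spow0 mulr0; apply/is_derive1_caratheodory; exists (spow p).
  split => [z||]; last exact: spow0.
    rewrite normr0 powR0 ?subr0; last by rewrite gt_eqF // (lt_trans ltr01).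
    rewrite /spow -mulrA -expr2 -real_normK ?num_real //.
    have [->|z0] := eqVneq z 0.
      by rewrite normr0 expr0n /= mulr0 powR0 // gt_eqF // (lt_trans ltr01).
    rewrite -powR_mulrn // -powRD; last by rewrite normr_eq0 z0 implybT.
    by congr (_ `^ _); lra.
  suff : spow p z @[z --> (0 : R)] --> (0 : R).
    by rewrite /prop_for /continuous_at spow0.
  apply/cvgr0Pnorm_lt => e e0.
  (* The radius solves [r^(p-1) = e], because [|spow p z| = |z|^(p-1)]. *)
  apply/nbhs_ballP; exists (e `^ (p - 1)^-1) => /=; first exact: powR_gt0.
  move=> z; rewrite /ball /= sub0r normrN norm_spow // => ze.
  have -> : e = (e `^ (p - 1)^-1) `^ (p - 1).
    by rewrite -powRrM mulVf ?powRr1 ?ltW // subr_eq0 gt_eqF.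
  by rewrite gt0_ltr_powR ?subr_gt0 // nnegrE ?powR_ge0.
- have -> : (fun y : R => `|y| `^ p) = (fun y : R => `|y| `^ p) \o -%R.
    by apply/funext => y /=; rewrite normrN.
  have Nx0 : 0 < - x by rewrite oppr_gt0.
  have := posE _ Nx0 => dp.
  apply: (is_derive_eq (is_derive1_comp dp (is_deriveNid _ _))).
  by rewrite spowN; ring.
- exact: posE.
Unshelve. all: by end_near. Qed.

Lemma continuous_norm_powR p : 1 < p -> continuous (fun y : R => `|y| `^ p).
Proof.
move=> p1 x; apply: differentiable_continuous; apply/derivable1_diffP.
by have [] := is_derive_norm_powR x p1.
Qed.

Lemma is_derive_bigsum (I : Type) (r : seq I) (P : pred I) (F : I -> R -> R)
    (D : I -> R) x :
  (forall i, is_derive x 1 (F i) (D i)) ->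
  is_derive x 1 (fun y => \sum_(i <- r | P i) F i y) (\sum_(i <- r | P i) D i).
Proof.
move=> dF; elim: r => [|i r IH].
  rewrite big_nil; under eq_fun do rewrite big_nil; exact: is_derive_cst.
rewrite big_cons; under eq_fun do rewrite big_cons.
by case: (P i) => //; exact: is_deriveD.
Qed.

End RealFunctions.

Import ArrowAsProduct.

(** * Weighted power sums and minimization on their unit level set *)

Section PSums.
Variables (R : realType) (V : finType).
Implicit Types (u v w : V -> R) (a p t c : R) (k : V).

(** Serves both as the constraint (positive weights [mu * f], exponent [alpha]) and as the potential
    term of the energy (weights [mu * h] of any sign, exponent [p]). *)
Definition psum w a u : R := \sum_i w i * `|u i| `^ a.

(** The line through [u] in the [k]-th coordinate direction, so that partial derivatives become
    derivatives in one real variable. *)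
Definition bump u k t : V -> R := fun i => u i + t * (i == k)%:R.

Lemma psumZ w a c u : psum w a (fun i => c * u i) = `|c| `^ a * psum w a u.
Proof.
by rewrite mulr_sumr; apply: eq_bigr => i _; rewrite normrM powRM // mulrCA.
Qed.

Lemma psum_norm w a u : psum w a (fun i => `|u i|) = psum w a u.
Proof. by apply: eq_bigr => i _; rewrite normr_id. Qed.

Lemma psum_ge0 w a u : (forall i, 0 < w i) -> 0 <= psum w a u.
Proof. by move=> w0; apply: sumr_ge0 => i _; rewrite mulr_ge0 ?powR_ge0 ?ltW. Qed.

Lemma psum_eq0 w a u : (forall i, 0 < w i) -> psum w a u = 0 -> u =1 fun=> 0.
Proof.
move=> w0 /eqP; rewrite psumr_eq0 => [/allP h i|i _]; last first.
  by rewrite mulr_ge0 ?powR_ge0 ?ltW.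
have := h i (mem_index_enum i).
by rewrite /= mulf_eq0 gt_eqF //= => /eqP/powR_eq0_eq0/normr0_eq0.
Qed.

Lemma psum_cst0 w a : a != 0 -> psum w a (fun=> 0) = 0.
Proof. by move=> a0; apply: big1 => i _; rewrite normr0 powR0 ?mulr0. Qed.

Lemma psum_normalize w a u : a != 0 -> 0 < psum w a u ->
  psum w a (fun i => psum w a u `^ (- a^-1) * u i) = 1.
Proof.
move=> a0 u0; rewrite psumZ ger0_norm ?powR_ge0 // -powRrM mulNr mulVf //.
by rewrite powR_inv1 ?ltW // mulVf ?gt_eqF.
Qed.

Lemma is_derive_bump u k i t :
  is_derive t 1 (fun s => bump u k s i) (i == k)%:R.
Proof.
apply/is_derive1_caratheodory; exists (fun=> (i == k)%:R).
by split=> // [z|]; [rewrite /bump; ring | exact: cvg_cst].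
Qed.

Lemma bump0 u k : bump u k 0 = u.
Proof. by apply/funext => i; rewrite /bump mul0r addr0. Qed.

Lemma is_derive_psum w p u k : 1 < p ->
  is_derive (0 : R) 1 (fun t => psum w p (bump u k t)) (p * (w k * spow p (u k))).
Proof.
move=> p1; have -> : p * (w k * spow p (u k)) =
    \sum_i w i * (p * spow p (u i) * (i == k)%:R).
  rewrite (bigD1 k) //= eqxx big1 ?addr0 => [|i /negbTE ->].
    by rewrite mulr1; ring.
  by rewrite !mulr0.
apply: is_derive_bigsum => i; apply: is_deriveZ.
have := is_derive_bump u k i 0 => dg.
apply: (is_derive1_comp (f := fun y : R => `|y| `^ p)).
by rewrite bump0; exact: is_derive_norm_powR.
Qed.

Lemma continuous_sum (T : topologicalType) (I : Type) (r : seq I)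
    (P : pred I) (F : I -> T -> R) :
  (forall i, continuous (F i)) ->
  continuous (fun x => \sum_(i <- r | P i) F i x).
Proof.
move=> cF; elim: r => [|i r IH].
  under eq_fun do rewrite big_nil.
  exact: cst_continuous.
under eq_fun do rewrite big_cons.
by case: (P i) => // x; apply: cvgD; [exact: cF | exact: IH].
Qed.

Lemma continuous_lincomb (T : topologicalType) (F G : T -> R) c :
  continuous F -> continuous G -> continuous (fun x => c * F x - G x).
Proof.
by move=> cF cG x; apply: cvgB; [apply: cvgMl_tmp; exact: cF | exact: cG].
Qed.

Lemma continuous_psum w a : 1 < a -> continuous (psum w a).
Proof.
move=> a1; rewrite /psum; apply: continuous_sum => i.
have cw : continuous (fun y : R => w i * `|y| `^ a).
  by move=> y; apply: cvgMl_tmp; exact: continuous_norm_powR.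
move=> u; exact: (@continuous_comp _ _ _ (proj i) _ u
  (@proj_continuous _ (fun=> R) i u) (cw _)).
Qed.

(** In the product topology on [V -> R] the constraint set is closed and lies in a product of
    segments, hence is compact by Tychonoff; the vertex [i0] makes it nonempty. *)
Lemma exists_min_psum1 w a (J : (V -> R) -> R) (i0 : V) : 1 < a ->
  (forall i, 0 < w i) -> continuous J ->
  exists2 u, psum w a u = 1 & forall v, psum w a v = 1 -> J u <= J v.
Proof.
move=> a1 w0 cJ; have a0 : 0 < a by rewrite (lt_trans _ a1).
(* Each single term obeys [w i * |u i|^a <= 1], since the terms are nonnegative and sum to 1;
   solving for [|u i|] gives [b i]. *)
pose b i := (w i)^-1 `^ a^-1.
have psum1_le u : psum w a u = 1 -> forall i, `|u i| <= b i.
  move=> u1 i; rewrite -(@powRr1 _ `|u i|) // -(@mulfV _ a) ?gt_eqF // powRrM.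
  rewrite ge0_ler_powR ?nnegrE ?invr_ge0 ?powR_ge0 ?(ltW a0) ?(ltW (w0 i)) //.
  rewrite -(ler_pM2l (w0 i)) mulfV ?gt_eqF // -u1 /psum (bigD1 i) //=.
  rewrite lerDl; apply: sumr_ge0 => j _.
  by rewrite mulr_ge0 ?powR_ge0 ?ltW.
pose S : set (V -> R) := [set u | psum w a u = 1].
have cS : compact S.
  apply: (@subclosed_compact _ _ [set u | forall i, `[- b i, b i] (u i)]).
  - apply: (@preimage_closed _ _ (psum w a) [set x | x = 1]).
      by move=> u _; exact: continuous_psum.
    exact: closed_eq.
  - exact: (@tychonoff V (fun=> R) (fun i => `[- b i, b i])
      (fun i => @segment_compact R (- b i) (b i))).
  - by move=> u /psum1_le ub i /=; rewrite in_itv /= -ler_norml.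
have [||u uS umin] := @compact_EVT_min _ _ J S _ cS.
(* The constant function 1, rescaled onto the constraint set. *)
- exists (fun i => psum w a (fun=> 1) `^ (- a^-1) * 1).
  apply: psum_normalize; first by rewrite gt_eqF.
  rewrite /psum (bigD1 i0) //= normr1 powR1 mulr1 ltr_pwDl //.
  by apply: sumr_ge0 => i _; rewrite mulr1 ltW.
- exact: continuous_subspaceT.
by exists u => [|v v1]; [rewrite inE in uS | apply: umin; rewrite inE].
Qed.

End PSums.

(** * The energy functional, its homogeneity and its critical point equation *)

Section Energy.
Variables (R : realType) (V : finType) (adj : rel V) (omega : V -> V -> R).
Hypotheses (adj_sym : symmetric adj)
  (omega_gt0 : forall i j, adj i j -> 0 < omega i j)
  (omega_sym : forall i j, adj i j -> omega i j = omega j i).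
Implicit Types (u v w : V -> R) (p a c : R) (k : V).

(** The sum runs over ordered pairs, so each edge joining distinct vertices counts twice; [energy]
    compensates by the factor 1/2. *)
Definition dirichlet p u : R :=
  \sum_i \sum_(j | adj i j) omega i j * `|u j - u i| `^ p.

Lemma dirichletZ p c u :
  dirichlet p (fun i => c * u i) = `|c| `^ p * dirichlet p u.
Proof.
rewrite mulr_sumr; apply: eq_bigr => i _.
rewrite mulr_sumr; apply: eq_bigr => j _.
by rewrite -mulrBr normrM powRM // mulrCA.
Qed.

Lemma le_dirichlet_norm p u : 0 <= p ->
  dirichlet p (fun i => `|u i|) <= dirichlet p u.
Proof.
move=> p0; apply: ler_sum => i _; apply: ler_sum => j ij.
rewrite ler_wpM2l ?(ltW (omega_gt0 ij)) //.
by rewrite ge0_ler_powR ?nnegrE ?normr_ge0 ?ler_dist_dist.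
Qed.

Lemma continuous_dirichlet p : 1 < p -> continuous (dirichlet p).
Proof.
move=> p1; rewrite /dirichlet; apply: continuous_sum => i.
apply: continuous_sum => j.
have cw : continuous (fun y : R => omega i j * `|y| `^ p).
  by move=> y; apply: cvgMl_tmp; exact: continuous_norm_powR.
have cB : continuous (fun u : V -> R => u j - u i).
  move=> u; exact: (cvgB (@proj_continuous _ (fun=> R) j u)
    (@proj_continuous _ (fun=> R) i u)).
move=> u; exact: (@continuous_comp _ _ _ _ _ u (cB u) (cw _)).
Qed.

(** An edge at [k] is met once from each end. As [spow p] is odd and [omega] symmetric, both visits
    contribute the same amount, whence the factor 2. *)
Lemma is_derive_dirichlet p u k : 1 < p ->
  is_derive (0 : R) 1 (fun t => dirichlet p (bump u k t))
    (- (2 * p * \sum_(j | adj k j) omega k j * spow p (u j - u k))).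
Proof.
move=> p1; pose T i j := omega i j * (p * spow p (u j - u i)).
have TN i j : adj i j -> T i j = - T j i.
  by move=> ij; rewrite /T -[u i - u j]opprB spowN !mulrN opprK omega_sym.
have -> : - (2 * p * \sum_(j | adj k j) omega k j * spow p (u j - u k)) =
    \sum_i \sum_(j | adj i j)
      omega i j * (p * spow p (u j - u i) * ((j == k)%:R - (i == k)%:R)).
  have -> : 2 * p * (\sum_(j | adj k j) omega k j * spow p (u j - u k)) =
      \sum_(j | adj k j) T k j + \sum_(j | adj k j) T k j.
    have -> : \sum_(j | adj k j) T k j =
        p * \sum_(j | adj k j) omega k j * spow p (u j - u k).
      by rewrite mulr_sumr; apply: eq_bigr => j _; rewrite mulrCA.
    by ring.
  (* The first inner sum collects the pairs ending at [k], the second those starting at [k]; [TN]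
     turns the former into the negative of the latter. *)
  transitivity (\sum_i (\sum_(j | adj i j) T i j * (j == k)%:R
                       - \sum_(j | adj i j) T i j * (i == k)%:R)); last first.
    apply: eq_bigr => i _; rewrite -sumrB; apply: eq_bigr => j _.
    by rewrite -mulrBr /T !mulrA.
  rewrite sumrB opprD; congr (_ - _).
    rewrite [in LHS]big_mkcond -sumrN; apply: eq_bigr => i _ /=.
    rewrite big_mkcond (bigD1 k) //= big1 => [|j /negbTE ->]; last first.
      by rewrite mulr0 if_same.
    rewrite eqxx mulr1 addr0 adj_sym; case: ifP => [ik|]; last by rewrite oppr0.
    by rewrite (TN _ _ ik).
  rewrite [in RHS](bigD1 k) //= [X in _ = _ + X]big1 ?addr0 => [|i /negbTE ->].
    by apply: eq_bigr => j _; rewrite eqxx mulr1.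
  by apply: big1 => j _; rewrite mulr0.
apply: is_derive_bigsum => i; apply: is_derive_bigsum => j.
apply: is_deriveZ.
have dB : is_derive (0 : R) 1 (fun t => bump u k t j - bump u k t i)
    ((j == k)%:R - (i == k)%:R).
  by apply: is_deriveB; exact: is_derive_bump.
apply: (is_derive1_comp (f := fun y : R => `|y| `^ p)).
by rewrite bump0; exact: is_derive_norm_powR.
Qed.

Lemma plaplacianE mu p u k :
  plaplacian adj mu omega p u k =
  (mu k)^-1 * \sum_(j | adj k j) omega k j * spow p (u j - u k).
Proof. by congr (_ * _); apply: eq_bigr => j _; rewrite mulrA. Qed.

Definition energy w p u : R := 2^-1 * dirichlet p u - psum w p u.

Lemma energyZ w p c u : energy w p (fun i => c * u i) = `|c| `^ p * energy w p u.
Proof. by rewrite /energy dirichletZ psumZ; ring. Qed.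

Lemma le_energy_norm w p u : 0 <= p ->
  energy w p (fun i => `|u i|) <= energy w p u.
Proof.
move=> p0; rewrite /energy psum_norm lerD2r ler_pM2l ?invr_gt0 //.
exact: le_dirichlet_norm.
Qed.

Lemma continuous_energy w p : 1 < p -> continuous (energy w p).
Proof.
move=> p1; apply: continuous_lincomb; first exact: continuous_dirichlet.
exact: continuous_psum.
Qed.

(** The exponent [p / a] makes both sides homogeneous of degree [p], so a nonzero [v] can be
    rescaled onto the constraint set; for [v = 0] both sides vanish. *)
Lemma energy_min_bound w w' p a u : 0 < p -> 0 < a -> (forall i, 0 < w' i) ->
  (forall v, psum w' a v = 1 -> energy w p u <= energy w p v) ->
  forall v, energy w p u * psum w' a v `^ (p / a) <= energy w p v.
Proof.
move=> p0 a0 w'0 umin v.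
have [v0|] := eqVneq (psum w' a v) 0.
  have -> : v = fun i => 0 * v i.
    by apply/funext => i; rewrite mul0r (psum_eq0 w'0 v0).
  by rewrite energyZ psumZ normr0 !powR0 ?mul0r ?powR0 ?mulr0 ?gt_eqF ?divr_gt0.
rewrite neq_lt ltNge psum_ge0 //= => v0.
rewrite -ler_pdivlMr ?powR_gt0 // mulrC -powRN.
have -> : psum w' a v `^ (- (p / a)) = `|psum w' a v `^ (- a^-1)| `^ p.
  by rewrite ger0_norm ?powR_ge0 // -powRrM mulNr mulrC.
by rewrite -energyZ; apply: umin; rewrite psum_normalize ?gt_eqF.
Qed.

Lemma energy_critical w w' p a u k : 1 < p -> 1 < a -> (forall i, 0 < w' i) ->
  psum w' a u = 1 ->
  (forall v, psum w' a v = 1 -> energy w p u <= energy w p v) ->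
  \sum_(j | adj k j) omega k j * spow p (u j - u k) + w k * spow p (u k) =
  - energy w p u * (w' k * spow a (u k)).
Proof.
move=> p1 a1 w'0 u1 umin; set m := energy w p u.
have p0 : 0 < p := lt_trans ltr01 p1.
have a0 : 0 < a := lt_trans ltr01 a1.
(* The outer power is differentiated at the base point 1, so it is smooth there and contributes just
   the factor [p / a]. *)
have dN : is_derive (0 : R) 1 (fun t => psum w' a (bump u k t) `^ (p / a))
    (p / a * (a * (w' k * spow a (u k)))).
  have dp := is_derive_psum w' u k a1.
  apply: (is_derive_eq (is_derive1_comp (f := fun y : R => y `^ (p / a))
    (is_derive1_powR (p / a) _) dp)).
    by rewrite bump0 u1.
  by rewrite bump0 u1 powR1 mulr1.
have dE : is_derive (0 : R) 1 (fun t => energy w p (bump u k t) -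
    m * psum w' a (bump u k t) `^ (p / a))
    (2^-1 * - (2 * p * \sum_(j | adj k j) omega k j * spow p (u j - u k))
    - p * (w k * spow p (u k)) - m * (p / a * (a * (w' k * spow a (u k))))).
  have dD := is_derive_dirichlet u k p1.
  exact: (is_deriveB (is_deriveB (is_deriveZ 2^-1 dD) (is_derive_psum w u k p1))
    (is_deriveZ m dN)).
have /(is_derive_at_min dE) : forall t,
    energy w p (bump u k 0) - m * psum w' a (bump u k 0) `^ (p / a) <=
    energy w p (bump u k t) - m * psum w' a (bump u k t) `^ (p / a).
  move=> t; rewrite bump0 u1 powR1 mulr1 subrr subr_ge0.
  exact: energy_min_bound.
set S := \sum_(_ | _) _ => E.
(* The vanishing derivative [E] is [- p] times the difference of the two sides of the goal. *)
apply/eqP; rewrite -subr_eq0; apply/eqP; apply: (mulfI (lt0r_neq0 p0)).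
rewrite mulr0 -[RHS]oppr0 -E.
by field; rewrite !gt_eqF.
Qed.

End Energy.

Theorem theorem2p1 (R : realType) (V : finType) (adj : rel V)
    (adj_sym : symmetric adj)
    (adj_conn : graph_connected adj)
    (mu : V -> R) (mu_gt0 : forall i, 0 < mu i)
    (omega : V -> V -> R)
    (omega_gt0 : forall i j, adj i j -> 0 < omega i j)
    (omega_sym : forall i j, adj i j -> omega i j = omega j i)
    (h f : V -> R) (f_gt0 : forall i, 0 < f i)
    (alpha p : R) (p_gt1 : 1 < p) (le_p_alpha : p <= alpha) :
  exists (lambda : R) (phi : V -> R),
    (forall i, 0 < phi i) /\
    (forall i, plaplacian adj mu omega p phi i + h i * phi i `^ (p - 1)
               = lambda * f i * phi i `^ (alpha - 1)).
Proof.
(* [graph_connected] admits the empty graph, where the constraint set is empty but the claim is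
   vacuous. *)
have [i0 _|V0] := pickP {: V}; last first.
  by exists 0, (fun=> 0); split=> i; have := V0 i; rewrite inE.
(* With these weights [energy_critical] gives the equation multiplied by [mu i]. *)
pose w i := mu i * h i; pose w' i := mu i * f i.
have w'0 i : 0 < w' i by rewrite mulr_gt0.
have p0 : 0 < p := lt_trans ltr01 p_gt1.
have alpha1 := lt_le_trans p_gt1 le_p_alpha.
have [u u1 umin] := exists_min_psum1 i0 alpha1 w'0
  (@continuous_energy _ _ adj omega w _ p_gt1).
pose phi i := `|u i|.
have phi_ge0 i : 0 <= phi i by exact: normr_ge0.
have phi1 : psum w' alpha phi = 1 by rewrite psum_norm.
have phimin v : psum w' alpha v = 1 ->
    energy adj omega w p phi <= energy adj omega w p v.
  move=> /umin; apply: le_trans.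
  exact: (le_energy_norm omega_gt0 _ _ (ltW p0)).
have crit k :=
  energy_critical adj_sym omega_sym k p_gt1 alpha1 w'0 phi1 phimin.
have zero_closed i j : adj i j -> phi i = 0 -> phi j = 0.
  move=> ij phii; move: (crit i); rewrite phii !spow0 !mulr0 addr0.
  move=> /eqP; rewrite psumr_eq0 => [/allP /(_ j (mem_index_enum j))|l il].
    rewrite /= ij subr0 ge0_spow // mulf_eq0 gt_eqF ?omega_gt0 //=.
    by move=> /eqP/powR_eq0_eq0.
  by rewrite subr0 ge0_spow // mulr_ge0 ?powR_ge0 // ltW ?omega_gt0.
have phi_gt0 i : 0 < phi i.
  rewrite lt_def phi_ge0 andbT; apply/eqP => phii.
  have phi0 : phi = fun=> 0.
    (* [fingraph.closed] asks for equal membership at both ends of an edge, so [zero_closed] is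
       applied in both directions. *)
    have zero_conn : fingraph.closed adj [pred l | phi l == 0].
      by move=> l l' ll'; apply/eqP/eqP; apply: zero_closed; rewrite // adj_sym.
    apply/funext => j; apply/eqP; rewrite -[_ == _]/(j \in [pred l | phi l == 0]).
    by rewrite -(closed_connect zero_conn (adj_conn i j)); exact/eqP.
  have := phi1; rewrite phi0 psum_cst0 ?gt_eqF ?(lt_le_trans p0) // => /eqP.
  by rewrite eq_sym oner_eq0.
exists (- energy adj omega w p phi), phi; split=> // i.
apply: (mulfI (lt0r_neq0 (mu_gt0 i))).
rewrite plaplacianE mulrDr mulVKf ?gt_eqF // mulrA.
have := crit i; rewrite !(ge0_spow _ (phi_ge0 i)) // => ->.
by rewrite /w'; ring.
Qed.
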